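(* For every positive integer $k$, there exist strong tournaments with minimum in-degree and minimum out-degree at least $k$ containing an arc which is not in any spanning eulerian subdigraph.
   Context: A tournament is a digraph (finite, no loops) in which for any two distinct vertices $x,y$ exactly one of $xy$, $yx$ is an arc. A digraph is strong if it has an $(s,t)$-path for each ordered pair of distinct vertices $s,t$. A digraph is eulerian if it is connected and every vertex has in-degree equal to out-degree; a subdigraph is spanning if it contains all vertices. *)

(* Defs.v *)
From mathcomp Require Import all_boot.

Set Implicit Arguments.
Unset Strict Implicit.
Unset Printing Implicit Defensive.

(* The vertex set is a subset of an ambient finite type, so that a digraph and
   its subdigraphs, spanning or not, live in the same type. *)
Record digraph (T : finType) := Digraph {
  vset : {set T};
  is_arc : rel T;
  is_arc_vset : forall x y, is_arc x y -> (x \in vset) && (y \in vset);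
  is_arc_irrefl : irreflexive is_arc
}.

Section Digraphs.
Variable T : finType.
Implicit Types D H : digraph T.

Definition tournament D : Prop :=
  {in vset D &, forall x y, x != y -> is_arc D x y (+) is_arc D y x}.

Definition outdeg D (x : T) : nat := #|[set y | is_arc D x y]|.
Definition indeg D (x : T) : nat := #|[set y | is_arc D y x]|.

(* Degrees never exceed #|vset D|, so this default value does not affect the
   minimum when vset D is nonempty. *)
Definition min_outdeg D : nat := \big[minn/#|vset D|]_(x in vset D) outdeg D x.
Definition min_indeg D : nat := \big[minn/#|vset D|]_(x in vset D) indeg D x.

Definition strong D : Prop :=
  {in vset D &, forall s t, s != t -> connect (is_arc D) s t}.

(* Connectedness of the underlying undirected graph. *)
Definition connected D : Prop :=
  {in vset D &, forall s t, connect [rel x y | is_arc D x y || is_arc D y x] s t}.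

Definition eulerian D : Prop :=
  connected D /\ {in vset D, forall x, indeg D x = outdeg D x}.

Definition subdigraph H D : Prop :=
  vset H \subset vset D /\ subrel (is_arc H) (is_arc D).

Definition spanning H D : Prop := vset H = vset D.

End Digraphs.

(* Main.v *)
Require Import Defs.
From mathcomp Require Import all_boot.
From mathcomp Require Import zify.

                                                                              
                                                                             
                                                                        
                                                                              
                                                                           
                                                                               
                                                                     

(** Take three copies of the rotational tournament on [2 * k + 1] vertices, in which every in-degree
    and out-degree is [k]. Direct all arcs between copies from the lower to the higher index, except
    for one back arc from copy 2 to copy 0, which makes the tournament strong.

    An eulerian subdigraph has as many arcs leaving a vertex set as entering it ([eulerian_cut]).
    Only the back arc leaves copy 2, so at most one arc of the subdigraph enters it. If that arc
    comes from copy 0, none comes from copy 1; hence nothing leaves copy 1, so nothing enters it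
    either, and a spanning subdigraph is disconnected ([connected_cut]). Thus no arc from copy 0 to
    copy 2 lies in a spanning eulerian subdigraph ([arc_part0_part2_not_eulerian]). *)

Section CutBalance.
Variable T : finType.
Implicit Types (H : digraph T) (S : {set T}).

Definition out_cut H S : {set T * T} :=
  [set p | [&& is_arc H p.1 p.2, p.1 \in S & p.2 \notin S]].

Definition in_cut H S : {set T * T} :=
  [set p | [&& is_arc H p.1 p.2, p.1 \notin S & p.2 \in S]].

Lemma card_pairs (r : rel T) :
  #|[set p : T * T | r p.1 p.2]| = \sum_x \sum_y (r x y : nat).
Proof.
rewrite pair_big /= -sum1dep_card big_mkcond /=.
by apply: eq_bigr => -[x y] _ /=; case: (r x y).
Qed.

(** The out-degrees over [S] sum to the arcs inside [S] (relation [r]) plus those leaving it, the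
    in-degrees to the arcs inside plus those entering. The two sums agree and the inside arcs
    cancel. *)
Lemma eulerian_cut H S :
  S \subset vset H -> eulerian H -> #|out_cut H S| = #|in_cut H S|.
Proof.
move=> sSH [_ bal].
pose r x y := [&& is_arc H x y, x \in S & y \in S].
have outE : \sum_(x in S) outdeg H x =
    #|[set p : T * T | r p.1 p.2]| + #|out_cut H S|.
  rewrite (card_pairs r).
  rewrite (card_pairs (fun x y => [&& is_arc H x y, x \in S & y \notin S])).
  rewrite -big_split.
  rewrite big_mkcond /=; apply: eq_bigr => x _.
  rewrite -big_split /outdeg /r -sum1dep_card (big_mkcond (is_arc H x)) /=.
  case: (x \in S); last by rewrite big1 // => y _; rewrite !andbF.
  by apply: eq_bigr => y _; case: (is_arc H x y); case: (y \in S).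
have inE : \sum_(y in S) indeg H y =
    #|[set p : T * T | r p.1 p.2]| + #|in_cut H S|.
  rewrite (card_pairs r).
  rewrite (card_pairs (fun x y => [&& is_arc H x y, x \notin S & y \in S])).
  rewrite exchange_big [X in _ + X]exchange_big -big_split.
  rewrite big_mkcond /=; apply: eq_bigr => y _.
  rewrite -big_split /indeg /r -sum1dep_card (big_mkcond (is_arc H ^~ y)) /=.
  case: (y \in S); last by rewrite big1 // => x _; rewrite !andbF.
  by apply: eq_bigr => x _; case: (is_arc H x y); case: (x \in S).
have : \sum_(x in S) outdeg H x = \sum_(x in S) indeg H x.
  by apply: eq_bigr => x xS; rewrite bal // (subsetP sSH).
by rewrite outE inE => /addnI.
Qed.

(** With both cuts empty, [S] is closed under undirected adjacency, so no undirected path leads from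
    [x] to [y]. *)
Lemma connected_cut H S x y :
  connected H -> x \in S -> y \notin S -> x \in vset H -> y \in vset H ->
  out_cut H S = set0 -> in_cut H S = set0 -> False.
Proof.
move=> conH xS yS xH yH out0 in0; move: (conH x y xH yH).
have clS : closed [rel u v | is_arc H u v || is_arc H v u] S.
  move=> u v /= uv; apply/idP/idP => [uS|vS]; apply/negPn/negP => nS.
    case/orP: uv => uv.
      by have := in_set0 (u, v); rewrite -out0 inE /= uv uS nS.
    by have := in_set0 (v, u); rewrite -in0 inE /= uv uS nS.
  case/orP: uv => uv.
    by have := in_set0 (u, v); rewrite -in0 inE /= uv vS nS.
  by have := in_set0 (v, u); rewrite -out0 inE /= uv vS nS.
by move=> /(closed_connect clS); rewrite xS (negbTE yS).
Qed.

(** The bound on [#|vset D|] takes care of the default value of the minimum. *)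
Lemma leq_min_outdeg k (D : digraph T) :
  k <= #|vset D| -> (forall x, k <= outdeg D x) -> k <= min_outdeg D.
Proof.
move=> kD kout; apply: (big_ind (leq k)) => // m n km kn.
by rewrite leq_min km.
Qed.

Lemma leq_min_indeg k (D : digraph T) :
  k <= #|vset D| -> (forall x, k <= indeg D x) -> k <= min_indeg D.
Proof.
move=> kD kin; apply: (big_ind (leq k)) => // m n km kn.
by rewrite leq_min km.
Qed.

End CutBalance.

Arguments out_cut {T} H S.
Arguments in_cut {T} H S.

                                                                             
(** For [u] and [v] at most [2 * k], this says that [v - u] modulo [2 * k + 1] lies between 1 and
    [k]. *)
Definition rotational (k u v : nat) : bool :=
  ((u < v) && (v - u <= k)) || ((v < u) && (k < u - v)).

Section ThreeParts.
Variable k : nat.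
Hypothesis k_gt0 : 0 < k.

Local Notation V := ('I_3 * 'I_(2 * k).+1)%type.

Definition back_arc (x y : V) : bool :=
  [&& x.1 == 2 :> nat, y.1 == 0 :> nat, x.2 == 0 :> nat & y.2 == 0 :> nat].

(** The conjunct [~~ back_arc y x] deletes the one forward arc opposite to the back arc. *)
Definition part_arc (x y : V) : bool :=
  if x.1 == y.1 then rotational k x.2 y.2
  else back_arc x y || (x.1 < y.1) && ~~ back_arc y x.

Lemma part_arc_irrefl : irreflexive part_arc.
Proof. by move=> [i u]; rewrite /part_arc /rotational eqxx /= ltnn. Qed.

Lemma part_arc_setT x y :
  part_arc x y -> (x \in [set: V]) && (y \in [set: V]).
Proof. by rewrite !in_setT. Qed.

Definition parts : digraph V := Digraph part_arc_setT part_arc_irrefl.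

Definition part (i : 'I_3) : {set V} := [set x | x.1 == i].

Lemma parts_tournament : tournament parts.
Proof.
move=> [i u] [j v] _ _; rewrite xpair_eqE /= /part_arc /back_arc /rotational /=.
rewrite (eq_sym j i) -!val_eqE /=.
have := ltn_ord u; have := ltn_ord v; have := ltn_ord i; have := ltn_ord j.
by case: eqP => /= [_|ij]; lia.
Qed.

(** Here [f] enumerates [k] distinct elements of [P]; its values are naturals, so that the side
    conditions become linear arithmetic. *)
Lemma leq_card_rotational (P : pred 'I_(2 * k).+1) (f : nat -> nat) :
    {in gtn k &, injective f} ->
    (forall d, d < k -> f d < (2 * k).+1) ->
    (forall d (v : 'I_(2 * k).+1), d < k -> v = f d :> nat -> P v) ->
  k <= #|[set v | P v]|.
Proof.
move=> f_inj f_lt fP.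
pose g (d : 'I_k) := Ordinal (f_lt d (ltn_ord d)).
have g_inj : injective g.
  by move=> d e /(congr1 val) /= /f_inj de; apply/val_inj/de; apply: ltn_ord.
rewrite -[leqLHS]card_ord -(card_imset _ g_inj); apply: subset_leq_card.
by apply/subsetP => _ /imsetP[d _ ->]; rewrite inE (fP d).
Qed.

(** Lets the degree bounds count only neighbours within the vertex's own copy. *)
Lemma leq_fiber_card (i : 'I_3) (P : pred V) :
  #|[set v | P (i, v)]| <= #|[set y | P y]|.
Proof.
have pair_inj : injective (fun v : 'I_(2 * k).+1 => (i, v)) by move=> u v [].
rewrite -(card_imset _ pair_inj); apply: subset_leq_card.
by apply/subsetP => _ /imsetP[v + ->]; rewrite !inE.
Qed.

Lemma parts_outdeg x : k <= outdeg parts x.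
Proof.
case: x => i u; apply: leq_trans (leq_fiber_card i (part_arc (i, u))).
have u_lt := ltn_ord u.
(* The out-neighbours [u + 1], ..., [u + k], reduced modulo [2 * k + 1]. *)
apply: (@leq_card_rotational _ (fun d =>
  if u + d.+1 < (2 * k).+1 then u + d.+1 else u + d.+1 - (2 * k).+1)).
- by move=> d e; rewrite !inE /=; do 2!case: ifP; lia.
- by move=> d; case: ifP; lia.
- by move=> d v; rewrite /part_arc /rotational /= eqxx; case: ifP; lia.
Qed.

Lemma parts_indeg x : k <= indeg parts x.
Proof.
case: x => i u; apply: leq_trans (leq_fiber_card i (part_arc^~ (i, u))).
have u_lt := ltn_ord u.
(* The in-neighbours [u - 1], ..., [u - k], reduced modulo [2 * k + 1]. *)
apply: (@leq_card_rotational _ (fun d =>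
  if d < u then u - d.+1 else u + (2 * k).+1 - d.+1)).
- by move=> d e; rewrite !inE /=; do 2!case: ifP; lia.
- by move=> d; case: ifP; lia.
- by move=> d v; rewrite /part_arc /rotational /= eqxx; case: ifP; lia.
Qed.

Lemma leq_card_parts : k <= #|vset parts|.
Proof. by rewrite cardsT card_prod !card_ord; lia. Qed.

Lemma connect_part_upward i (u v : 'I_(2 * k).+1) :
  u <= v -> connect part_arc (i, u) (i, v).
Proof.
case: v => m; elim: m => [|m IHm] lt_m /= le_um.
  by rewrite (_ : u = Ordinal lt_m) ?connect0 //; apply: val_inj => /=; lia.
have [u_eq|u_lt] := eqVneq (u : nat) m.+1.
  by rewrite (_ : u = Ordinal lt_m) ?connect0 //; apply: val_inj.
apply: connect_trans (IHm (ltnW lt_m) _) _ => /=; first by lia.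
by apply: connect1; rewrite /part_arc /rotational /= eqxx; lia.
Qed.

(** Follow the cycle 0, 1, ..., [2 * k], 0; its closing arc exists because [2 * k > k]. *)
Lemma connect_part i (u v : 'I_(2 * k).+1) : connect part_arc (i, u) (i, v).
Proof.
apply: (@connect_trans _ _ (i, ord_max)).
  by apply: connect_part_upward; rewrite /= -ltnS ltn_ord.
apply: (@connect_trans _ _ (i, ord0)); last exact: connect_part_upward.
by apply: connect1; rewrite /part_arc /rotational /= eqxx; lia.
Qed.

Lemma parts_strong : strong parts.
Proof.
have up (i j : 'I_3) u v : i <= j -> connect part_arc (i, u) (j, v).
  move=> le_ij; have [->|ij] := eqVneq i j; first exact: connect_part.
  (* Leaving from index [ord_max], which is nonzero, avoids the reversed pair. *)
  apply: connect_trans (connect_part i u ord_max) _; apply: connect1.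
  have lt_ij : i < j by rewrite ltn_neqAle ij.
  by rewrite /part_arc /back_arc -val_eqE /= (ltn_eqF lt_ij); lia.
move=> [i u] [j v] _ _ _ /=.
(* Go up to the tail of the back arc, cross it, then go up to the target. *)
apply: (@connect_trans _ _ (ord_max, ord0)).
  by apply: up; rewrite /= -ltnS ltn_ord.
by apply: (@connect_trans _ _ (ord0, ord0)); [exact: connect1 | exact: up].
Qed.

Lemma arc_part0_part2_not_eulerian (H : digraph V) x y :
    subdigraph H parts -> spanning H parts -> eulerian H ->
  x \in part ord0 -> y \in part ord_max -> ~~ is_arc H x y.
Proof.
move=> [_ sHD] spanH eulH; rewrite !inE => /eqP x0 /eqP y2; apply/negP => Hxy.
have HT z : z \in vset H by rewrite spanH inE.
have HS (S : {set V}) : S \subset vset H by apply/subsetP.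
pose i1 : 'I_3 := inord 1.
have i1E : i1 = 1 :> nat by rewrite inordK.
have in2_le1 : #|in_cut H (part ord_max)| <= 1.
  pose a : V := (ord0, ord0); pose b : V := (ord_max, ord0).
  (* Balance turns the claim into a bound on the arcs leaving the last copy, where [(b, a)] is the
     only candidate. *)
  rewrite -eulerian_cut //; apply: (@leq_trans #|[set (b, a)]|); last by rewrite cards1.
  apply/subset_leq_card/subsetP => -[[i u] [j v]].
  rewrite !inE -!val_eqE /= => /and3P[/sHD + /eqP i2 j2].
  rewrite /= /part_arc /back_arc !xpair_eqE -!val_eqE /= i2.
  rewrite (eq_sym 2) (negbTE j2).
  by have := ltn_ord j; lia.
have out1 : out_cut H (part i1) = set0.
  apply/eqP; rewrite -subset0; apply/subsetP => -[z w]; rewrite !inE /=.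
  move=> /and3P[Hzw /eqP z1 w1]; have := sHD _ _ Hzw.
  rewrite /= /part_arc /back_arc z1 eq_sym (negbTE w1) i1E /= => /andP[w_gt1 _].
  have w2 : w.1 = ord_max.
    by apply/ord_inj/eqP; rewrite eqn_leq /= w_gt1 -ltnS ltn_ord.
  (* Both arcs enter the last copy, which admits at most one; but [z] is in copy 1 and [x] in copy
     0. *)
  have zwE : (z, w) = (x, y).
    apply: (card_le1_eqP in2_le1); rewrite !inE /= ?Hzw ?Hxy ?w2 ?y2 eqxx andbT.
      by rewrite x0 -val_eqE.
    by rewrite z1 -val_eqE /= i1E.
  by have := congr1 val x0; case: zwE => <- _; rewrite z1 /= i1E.
have in1 : in_cut H (part i1) = set0.
  by apply/eqP; rewrite -cards_eq0 -eulerian_cut // out1 cards0.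
apply: (connected_cut _ H (part i1) (i1, ord0) x) => //; first by case: eulH.
  by rewrite inE.
by rewrite inE x0 -val_eqE /= i1E.
Qed.

End ThreeParts.

Theorem proposition17 (k : nat) (hk : 0 < k) :
  exists (T : finType) (D : digraph T),
    [/\ tournament D, strong D, k <= min_indeg D, k <= min_outdeg D
      & exists x y : T, is_arc D x y /\
          ~ (exists H : digraph T,
               [/\ subdigraph H D, spanning H D, eulerian H & is_arc H x y])].
Proof.
exists _, (parts k); split.
- exact: parts_tournament.
- exact: parts_strong.
- by apply: leq_min_indeg; [exact: leq_card_parts | exact: parts_indeg].
- by apply: leq_min_outdeg; [exact: leq_card_parts | exact: parts_outdeg].
(* The head has index [ord_max] because [(ord0, ord0)] and [(ord_max, ord0)] are joined by the back
   arc. *)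
exists (ord0, ord0), (ord_max, ord_max); split.
  by rewrite /= /part_arc /back_arc /=; lia.
move=> [H [subH spanH eulH]]; apply/negP.
by apply: arc_part0_part2_not_eulerian; rewrite ?inE.
Qed.
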